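(* Given a weighted temporal graph $G=(V,E)$ and $s,z\in V$, the following decision problems can be solved in polynomial time: (1) given an $(s,z)$-path $P$, decide whether $P$ is efficient with respect to duration and cost; (2) given $c\in\mathbb{R}_{\ge0}$ and $d\in\mathbb{N}$, decide whether there exists an $(s,z)$-path $P$ with $d(P)\le d$ and $c(P)\le c$.
   Context: A weighted temporal graph $G=(V,E)$ has temporal edges $e=(u,v,t,\lambda,c)$ with $u\neq v$, availability time $t\in\mathbb{N}$, traversal time $\lambda\in\mathbb{N}$, cost $c\in\mathbb{R}_{\ge0}$ (zero costs allowed). A temporal $(u,v)$-path is a sequence $(e_1,\ldots,e_k)$, $e_i=(v_i,v_{i+1},t_i,\lambda_i,c_i)\in E$, $v_1=u$, $v_{k+1}=v$, $t_i+\lambda_i\le t_{i+1}$ for $1\le i<k$, visiting each vertex at most once; starting time $s(P)=t_1$, arrival time $a(P)=t_k+\lambda_k$, duration $d(P)=a(P)-s(P)$, cost $c(P)=\sum_i c_i$. An $(s,z)$-path $P$ is efficient w.r.t. duration and cost if no $(s,z)$-path $Q$ has ($c(Q)<c(P)$ and $d(Q)\le d(P)$) or ($c(Q)\le c(P)$ and $d(Q)<d(P)$). *)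

(* Defs.v *)
From HB Require Import structures.
From mathcomp Require Import all_boot all_order all_algebra.
From mathcomp Require Import reals.

Set Implicit Arguments.
Unset Strict Implicit.
Unset Printing Implicit Defensive.

Import Order.TTheory GRing.Theory Num.Theory.
Local Open Scope ring_scope.

(** * Weighted temporal graphs *)

Record tedge (R : realType) (V : finType) := TEdge {
  src : V; dst : V; time : nat; trav : nat; cost : R }.

Definition tedge_tuple (R : realType) (V : finType) (e : tedge R V) :=
  (src e, dst e, time e, trav e, cost e).
Definition tuple_tedge (R : realType) (V : finType)
    (x : V * V * nat * nat * R) : tedge R V :=
  let: (u, v, t, l, c) := x in TEdge u v t l c.
Lemma tedge_tupleK (R : realType) (V : finType) :
  cancel (@tedge_tuple R V) (@tuple_tedge R V).
Proof. by case. Qed.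
HB.instance Definition _ (R : realType) (V : finType) :=
  Equality.copy (tedge R V) (can_type (@tedge_tupleK R V)).

(* The finite edge set is given by an arbitrary duplicate-free listing, so
   parallel edges are allowed as soon as they differ in some component. *)
Record wtgraph (R : realType) := WTGraph {
  vertex : finType;
  edges : seq (tedge R vertex);
  edges_uniq : uniq edges;
  edges_loopless : all (fun e => src e != dst e) edges;
  edges_cost_ge0 : all (fun e => 0 <= cost e) edges }.

Section Paths.
Variables (R : realType) (G : wtgraph R).
Implicit Types (s z : vertex G) (e f : tedge R (vertex G)).
Implicit Types (P Q : seq (tedge R (vertex G))).

Definition follows e f : bool :=
  (dst e == src f) && (time e + trav e <= time f)%N.

(* Paths have at least one edge, as starting and arrival times are otherwise
   undefined; hence there is no (s, s)-path. The last conjunct says that the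
   vertices v_1, ..., v_{k+1} are pairwise distinct. *)
Definition is_tpath s z P : bool :=
  if P is e :: P' then
    [&& all (fun f => f \in edges G) P, src e == s, path follows e P',
        dst (last e P') == z & uniq (src e :: map (@dst R (vertex G)) P)]
  else false.

Definition start_time P : nat := if P is e :: _ then time e else 0%N.

Definition arrival_time P : nat :=
  if P is e :: P' then (time (last e P') + trav (last e P'))%N else 0%N.

(* On temporal paths the start time never exceeds the arrival time, so the
   truncated subtraction is exact. *)
Definition duration P : nat := (arrival_time P - start_time P)%N.

Definition path_cost P : R := \sum_(e <- P) cost e.

Definition dominates Q P : Prop :=
  (path_cost Q < path_cost P /\ (duration Q <= duration P)%N) \/
  (path_cost Q <= path_cost P /\ (duration Q < duration P)%N).

Definition efficient s z P : Prop :=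
  ~ exists Q, is_tpath s z Q /\ dominates Q P.

End Paths.

(** * Polynomial time

   Costs are arbitrary reals, so the model of computation is a random access
   machine whose memory holds natural numbers and, separately, reals. It is
   presented as a structured imperative language over finitely many (one per
   index occurring in the program) infinite arrays of each sort, with indirect
   addressing. The operations are addition, truncated subtraction and comparison
   on naturals, and addition, subtraction and comparison on reals.

   There is no multiplication on either sort, no conversion between the sorts
   and no real constant but 0. Hence the numbers arising in T steps are at most
   O(T) bits longer than those of the input, and for rational costs unit-cost
   polynomial time is polynomial time on a Turing machine; a program cannot hide
   information in real constants. *)

Inductive nexpr : Type :=
| NConst (k : nat)
| NCell (a : nat) (i : nexpr)
| NAdd (x y : nexpr)
| NSub (x y : nexpr).

Inductive rexpr : Type :=
| RZero
| RCell (a : nat) (i : nexpr)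
| RAdd (x y : rexpr)
| RSub (x y : rexpr).

Inductive test : Type :=
| NLe (x y : nexpr)
| RLe (x y : rexpr)
| TNot (b : test)
| TAnd (b1 b2 : test).

Inductive program : Type :=
| Skip
| NSet (a : nat) (i x : nexpr)
| RSet (a : nat) (i : nexpr) (x : rexpr)
| Seq (p q : program)
| If (b : test) (p q : program)
| While (b : test) (p : program).

Record memory (R : realType) := Memory {
  nmem : nat -> nat -> nat;
  rmem : nat -> nat -> R }.

Definition update (T : Type) (m : nat -> nat -> T) (a i : nat) (x : T) :=
  fun a' i' => if (a' == a) && (i' == i) then x else m a' i'.

Section Semantics.
Variable R : realType.
Implicit Types M : memory R.

Fixpoint neval M (x : nexpr) : nat :=
  match x with
  | NConst k => k
  | NCell a i => nmem M a (neval M i)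
  | NAdd x y => (neval M x + neval M y)%N
  | NSub x y => (neval M x - neval M y)%N
  end.

Fixpoint reval M (x : rexpr) : R :=
  match x with
  | RZero => 0
  | RCell a i => rmem M a (neval M i)
  | RAdd x y => reval M x + reval M y
  | RSub x y => reval M x - reval M y
  end.

Fixpoint teval M (b : test) : bool :=
  match b with
  | NLe x y => (neval M x <= neval M y)%N
  | RLe x y => reval M x <= reval M y
  | TNot b => ~~ teval M b
  | TAnd b1 b2 => teval M b1 && teval M b2
  end.

(* [exec p M n M']: run from M, p halts in M' after n steps. Each assignment and
   each test counts as one step: the expressions occurring in a fixed program
   have bounded size. *)
Inductive exec : program -> memory R -> nat -> memory R -> Prop :=
| ExecSkip M : exec Skip M 1 M
| ExecNSet a i x M :
    exec (NSet a i x) M 1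
      (Memory (update (nmem M) a (neval M i) (neval M x)) (rmem M))
| ExecRSet a i x M :
    exec (RSet a i x) M 1
      (Memory (nmem M) (update (rmem M) a (neval M i) (reval M x)))
| ExecSeq p q M1 n M2 m M3 :
    exec p M1 n M2 -> exec q M2 m M3 -> exec (Seq p q) M1 (n + m) M3
| ExecIfTrue b p q M n M' :
    teval M b -> exec p M n M' -> exec (If b p q) M n.+1 M'
| ExecIfFalse b p q M n M' :
    ~~ teval M b -> exec q M n M' -> exec (If b p q) M n.+1 M'
| ExecWhileFalse b p M :
    ~~ teval M b -> exec (While b p) M 1 M
| ExecWhileTrue b p M1 n M2 m M3 :
    teval M1 b -> exec p M1 n M2 -> exec (While b p) M2 m M3 ->
    exec (While b p) M1 (n + m).+1 M3.

(* An encoded instance lists the initial contents of the arrays; all other cells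
   are initially zero. *)
Record input := Input { nat_data : seq (seq nat); real_data : seq (seq R) }.

Definition load (x : input) : memory R :=
  Memory (fun a i => nth 0%N (nth [::] (nat_data x) a) i)
         (fun a i => nth 0 (nth [::] (real_data x) a) i).

(* number of binary digits, with one digit for 0 *)
Definition bitlen (k : nat) : nat := (trunc_log 2 k).+1.

(* Naturals are measured in binary; a real number has size 1. *)
Definition input_size (x : input) : nat :=
  (\sum_(a <- nat_data x) \sum_(k <- a) bitlen k +
   \sum_(a <- real_data x) size a)%N.

Definition accepting M : Prop := nmem M 0 0 <> 0%N.

(* The decision problem on instances of type I, encoded by enc, with
   yes-instances yes. *)
Definition poly_time_decidable (I : Type) (enc : I -> input)
    (yes : I -> Prop) : Prop :=
  exists (p : program) (C k : nat), forall x : I,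
    exists (n : nat) (M : memory R),
      [/\ exec p (load (enc x)) n M,
          (n <= C * (input_size (enc x)).+1 ^ k)%N &
          accepting M <-> yes x].

End Semantics.

(** * The two decision problems *)

Section Problems.
Variable R : realType.

Definition vertex_code (V : finType) (v : V) : nat := enum_rank v.

Definition tedges_nats (V : finType) (E : seq (tedge R V)) : seq (seq nat) :=
  [:: [seq vertex_code (src e) | e <- E];
      [seq vertex_code (dst e) | e <- E];
      [seq time e | e <- E];
      [seq trav e | e <- E]].

Definition tedges_costs (V : finType) (E : seq (tedge R V)) : seq R :=
  [seq cost e | e <- E].

(* The vertex set is listed explicitly, so the size of a graph is at least its
   number of vertices. *)
Definition vertex_list (V : finType) : seq nat :=
  [seq vertex_code v | v <- enum V].

(* A path is given as its sequence of temporal edges. *)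
Record efficiency_instance := EfficiencyInstance {
  ei_graph : wtgraph R;
  ei_s : vertex ei_graph;
  ei_z : vertex ei_graph;
  ei_path : seq (tedge R (vertex ei_graph));
  ei_is_tpath : is_tpath ei_s ei_z ei_path }.

Definition encode_efficiency (x : efficiency_instance) : input R :=
  let E := edges (ei_graph x) in
  Input
    ([:: [:: #|vertex (ei_graph x)|; size E;
             vertex_code (ei_s x); vertex_code (ei_z x); size (ei_path x)];
         vertex_list (vertex (ei_graph x))]
     ++ tedges_nats E ++ tedges_nats (ei_path x))
    [:: tedges_costs E; tedges_costs (ei_path x)].

Definition efficiency_yes (x : efficiency_instance) : Prop :=
  efficient (ei_s x) (ei_z x) (ei_path x).

Record existence_instance := ExistenceInstance {
  xi_graph : wtgraph R;
  xi_s : vertex xi_graph;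
  xi_z : vertex xi_graph;
  xi_cost : R;
  xi_duration : nat;
  xi_cost_ge0 : 0 <= xi_cost }.

Definition encode_existence (x : existence_instance) : input R :=
  let E := edges (xi_graph x) in
  Input
    ([:: [:: #|vertex (xi_graph x)|; size E;
             vertex_code (xi_s x); vertex_code (xi_z x); xi_duration x];
         vertex_list (vertex (xi_graph x))]
     ++ tedges_nats E)
    [:: tedges_costs E; [:: xi_cost x]].

Definition existence_yes (x : existence_instance) : Prop :=
  exists P, [/\ is_tpath (xi_s x) (xi_z x) P,
                (duration P <= xi_duration x)%N &
                path_cost P <= xi_cost x].

End Problems.

(* Main.v *)
(** A temporal walk shortcuts to a temporal path that neither starts earlier, nor
    arrives later, nor costs more, because every vertex may be waited at. So it
    suffices to search walks: for every edge leaving [s], a Bellman-Ford iteration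
    on the line digraph (with [follows] as arcs) finds the cheapest walks that
    start with this edge, and the duration of such a walk is determined by its
    first and last edge. As paths have distinct edges, as many rounds as there
    are edges suffice. *)

Require Import Defs.
From mathcomp Require Import all_boot all_order all_algebra.
From mathcomp Require Import reals.
From mathcomp Require Import zify.

Set Implicit Arguments.
Unset Strict Implicit.
Unset Printing Implicit Defensive.

Import Order.TTheory GRing.Theory Num.Theory.

(** * Walks and paths *)

Section Walks.
Variables (R : realType) (G : wtgraph R).
Implicit Types (u v z : vertex G) (e f : tedge R (vertex G)).
Implicit Types (P Q : seq (tedge R (vertex G))).

(** A traveller waits at [v] from time [t] on and must reach [z] by the deadline [a]. Allowing
    repeated vertices and the empty sequence makes the notion inductive on edges, which [is_tpath]
    is not. *)
Fixpoint route v t z a P : bool :=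
  if P is e :: P' then
    [&& src e == v, t <= time e & route (dst e) (time e + trav e) z a P']
  else (v == z) && (t <= a).

Lemma routeE e z a P :
  route (dst e) (time e + trav e) z a P =
  [&& path (@follows R G) e P, dst (last e P) == z
    & time (last e P) + trav (last e P) <= a].
Proof.
elim: P e => [|f P IH] e //=.
by rewrite IH /follows eq_sym !andbA.
Qed.

Lemma route_start_le v t t' z a P :
  t' <= t -> route v t z a P -> route v t' z a P.
Proof.
case: P => [|e P] /= le_t; first by case/andP=> -> /(leq_trans le_t).
by case/and3P=> -> /(leq_trans le_t) -> ->.
Qed.

Lemma path_cost_cons e P : path_cost (e :: P) = (cost e + path_cost P)%R.
Proof. by rewrite /path_cost big_cons. Qed.

Lemma path_cost_nth P :
  path_cost P = (\sum_(0 <= k < size P) nth 0 (map (@cost R (vertex G)) P) k)%R.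
Proof.
rewrite /path_cost -(big_map (@cost R (vertex G)) xpredT id) (big_nth 0%R).
by rewrite size_map.
Qed.

(** The form in which [path_duration] computes the duration from arrays; on the empty sequence the
    default values make both sides 0. *)
Lemma duration_nth P :
  duration P = nth 0 (map (@time R (vertex G)) P) (size P - 1)
             + nth 0 (map (@trav R (vertex G)) P) (size P - 1)
             - nth 0 (map (@time R (vertex G)) P) 0.
Proof.
case: P => [|e P] //.
by rewrite subn1 !(nth_map e) // nth_last.
Qed.

Lemma cost_ge0 e : e \in edges G -> (0 <= cost e)%R.
Proof. exact: (allP (edges_cost_ge0 G)). Qed.

(** Drops the edges before the visit to [v]. The remaining route leaves [v] no earlier than [t], so
    one can wait there, and the dropped costs are nonnegative. *)
Lemma route_from u v t z a P :
    all (fun f => f \in edges G) P -> route u t z a P ->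
    v \in u :: map (@dst R (vertex G)) P ->
    uniq (u :: map (@dst R (vertex G)) P) ->
  exists Q, [/\ all (fun f => f \in edges G) Q, route v t z a Q,
    uniq (v :: map (@dst R (vertex G)) Q) & (path_cost Q <= path_cost P)%R].
Proof.
elim: P u t => [|e P IH] u t.
  by move=> _ rP; rewrite inE => /eqP-> _; exists [::].
rewrite inE; have [-> allP rP _ uP | _ /= /andP[eG PG]] := eqVneq v u.
  by exists (e :: P).
case/and3P=> _ le_t rP vP /andP[_ uP].
have [Q [QG rQ uQ leQ]] := IH _ _ PG rP vP uP.
exists Q; split=> //.
  by apply: route_start_le rQ; apply: leq_trans le_t (leq_addr _ _).
by rewrite path_cost_cons (le_trans leQ) // lerDr cost_ge0.
Qed.

(** Induction from the end: once the tail is shortcut, either it returns to [v] and [route_from]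
    cuts out the closed part, or the first edge can be put back. *)
Lemma route_shortcut v t z a P :
    all (fun f => f \in edges G) P -> route v t z a P ->
  exists Q, [/\ all (fun f => f \in edges G) Q, route v t z a Q,
    uniq (v :: map (@dst R (vertex G)) Q) & (path_cost Q <= path_cost P)%R].
Proof.
elim: P v t => [|e P IH] v t /=; first by move=> _ rP; exists [::].
case/andP=> eG PG /and3P[/eqP src_e le_t rP].
have [Q [QG rQ uQ leQ]] := IH _ _ PG rP.
case: (boolP (v \in map (@dst R (vertex G)) (e :: Q))) => [vQ | vNQ].
  have [Q' [Q'G rQ' uQ' leQ']] := route_from QG rQ vQ uQ.
  exists Q'; split=> //.
    by apply: route_start_le rQ'; apply: leq_trans le_t (leq_addr _ _).
  by rewrite path_cost_cons (le_trans leQ') // (le_trans leQ) // lerDr cost_ge0.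
exists (e :: Q); split; rewrite ?path_cost_cons ?lerD2l //.
- by rewrite /= eG.
- by rewrite /= src_e eqxx le_t.
- by rewrite cons_uniq vNQ.
Qed.

(** Shortcutting with the walk's own start and arrival times as limits cannot increase the duration.
    Distinct terminals prevent a closed walk from shrinking to the empty sequence. *)
Lemma walk_tpath e z P :
    e \in edges G -> all (fun f => f \in edges G) P ->
    path (@follows R G) e P -> dst (last e P) = z -> src e != z ->
  exists Q, [/\ is_tpath (src e) z Q, duration Q <= duration (e :: P)
    & (path_cost Q <= path_cost (e :: P))%R].
Proof.
move=> eG PG eP zP sNz.
have rP : route (src e) (time e) z (arrival_time (e :: P)) (e :: P).
  by rewrite /= eqxx leqnn routeE eP zP eqxx leqnn.
have [|[|f Q] [QG rQ uQ leQ]] := route_shortcut _ rP; first by rewrite /= eG.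
  by move: rQ; rewrite /= (negPf sNz).
move: rQ; rewrite [route _ _ _ _ _]/= routeE.
case/and3P=> /eqP src_f le_t /and3P[fQ zQ le_a].
exists (f :: Q); split=> //.
  by rewrite /is_tpath QG src_f eqxx fQ zQ.
by rewrite /duration [arrival_time (f :: Q)]/= [start_time _]/=
  [start_time _]/=; apply: leq_sub.
Qed.

(** Walks in the line digraph, grown at the end as relaxation does. The index counts arcs, hence is
    one less than the number of edges. *)
Inductive walk (e0 : tedge R (vertex G)) : nat -> tedge R (vertex G) -> R -> Prop :=
| Walk1 : walk e0 0 e0 (cost e0)
| WalkS l e f c : walk e0 l e c -> f \in edges G -> @follows R G e f ->
    walk e0 l.+1 f (c + cost f)%R.

Lemma walk_in e0 l e c : e0 \in edges G -> walk e0 l e c -> e \in edges G.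
Proof. by move=> e0G; case. Qed.

Lemma walk_path e0 l e c : walk e0 l e c ->
  exists P, [/\ all (fun f => f \in edges G) P, path (@follows R G) e0 P,
    last e0 P = e & path_cost (e0 :: P) = c].
Proof.
elim=> [|{}l {}e f {}c _ [P [PG eP lastP costP]] fG ef].
  by exists [::]; split; rewrite ?path_cost_cons /path_cost ?big_nil ?addr0.
exists (rcons P f); split; rewrite ?last_rcons //.
- by rewrite all_rcons fG.
- by rewrite rcons_path eP lastP.
- by rewrite -costP /path_cost -rcons_cons -cats1 big_cat big_seq1.
Qed.

Lemma path_walk e P : all (fun f => f \in edges G) P -> path (@follows R G) e P ->
  walk e (size P) (last e P) (path_cost (e :: P)).
Proof.
elim/last_ind: P => [_ _|P f IH].
  by rewrite /path_cost big_seq1; apply: Walk1.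
rewrite all_rcons rcons_path size_rcons last_rcons => /andP[fG PG] /andP[eP ef].
rewrite /path_cost -rcons_cons -cats1 big_cat big_seq1 /=.
exact: WalkS (IH PG eP) fG ef.
Qed.

(** Distinct heads force distinct edges; this bounds the number of rounds. *)
Lemma size_tpath s z P : is_tpath s z P -> size P <= size (edges G).
Proof.
case: P => [|e P] // /and5P[PG _ _ _ /andP[_ uP]].
have {}uP : uniq (map (@dst R (vertex G)) (e :: P)) := uP.
exact: uniq_leq_size (map_uniq uP) (allP PG).
Qed.

End Walks.

(** * Total correctness with time bounds *)

Section Triples.
Variable R : realType.
Implicit Types (M : memory R) (P Q S : memory R -> Prop).

Definition nset M a i x : memory R := Memory (update (nmem M) a i x) (rmem M).
Definition rset M a i x : memory R := Memory (nmem M) (update (rmem M) a i x).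

Definition triple P p T Q := forall M, P M ->
  exists n M', [/\ exec p M n M', n <= T & Q M'].

Lemma triple_weaken P P' p T T' Q Q' : triple P p T Q ->
  (forall M, P' M -> P M) -> T <= T' -> (forall M, Q M -> Q' M) ->
  triple P' p T' Q'.
Proof.
move=> tr PP' leT QQ' M /PP' /tr [n [M' [ex le_n QM']]].
by exists n, M'; split; [|apply: leq_trans leT|apply: QQ'].
Qed.

Lemma triple_skip P Q : (forall M, P M -> Q M) -> triple P Skip 1 Q.
Proof. by move=> PQ M PM; exists 1, M; split; [apply: ExecSkip| |apply: PQ]. Qed.

Lemma triple_nset P Q a i x :
  (forall M, P M -> Q (nset M a (neval M i) (neval M x))) ->
  triple P (NSet a i x) 1 Q.
Proof. by move=> PQ M /PQ QM; do 2!eexists; split; [apply: ExecNSet| |]. Qed.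

Lemma triple_rset P Q a i x :
  (forall M, P M -> Q (rset M a (neval M i) (reval M x))) ->
  triple P (RSet a i x) 1 Q.
Proof. by move=> PQ M /PQ QM; do 2!eexists; split; [apply: ExecRSet| |]. Qed.

Lemma triple_seq Q P S p q T U :
  triple P p T Q -> triple Q q U S -> triple P (Seq p q) (T + U) S.
Proof.
move=> trp trq M /trp [n [M1 [exp le_n /trq [n' [M2 [exq le_n' SM]]]]]].
by exists (n + n'), M2; split; [apply: ExecSeq exp exq|apply: leq_add|].
Qed.

Lemma triple_if P Q b p q T :
  triple (fun M => P M /\ teval M b) p T Q ->
  triple (fun M => P M /\ ~~ teval M b) q T Q ->
  triple P (If b p q) T.+1 Q.
Proof.
move=> trp trq M PM; case: (boolP (teval M b)) => bM.
  have [n [M' [ex le_n QM]]] := trp _ (conj PM bM).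
  by exists n.+1, M'; split; [apply: ExecIfTrue| |].
have [n [M' [ex le_n QM]]] := trq _ (conj PM bM).
by exists n.+1, M'; split; [apply: ExecIfFalse| |].
Qed.

Definition var a := NCell a (NConst 0).

(** The guard expresses [v < b] through the only comparison on naturals, and [b] is evaluated anew
    before each round. *)
Definition for_loop v b p :=
  Seq (NSet v (NConst 0) (NConst 0))
      (While (NLe (NAdd (var v) (NConst 1)) b)
         (Seq p (NSet v (NConst 0) (NAdd (var v) (NConst 1))))).

(** The invariant ignores the counter, whose value is passed to the body separately and must survive
    it. A round takes at most [T + 2] steps with its test and increment; the bound also absorbs the
    initialisation and the last test. *)
Lemma triple_for (I : nat -> memory R -> Prop) v b p m T :
  (forall i M x, I i M -> I i (nset M v 0 x)) ->
  (forall i M, I i M -> neval M b = m) ->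
  (forall i, i < m -> triple (fun M => I i M /\ nmem M v 0 = i) p T
                             (fun M => I i.+1 M /\ nmem M v 0 = i)) ->
  triple (I 0) (for_loop v b p) ((T + 4) * m.+1) (I m).
Proof.
move=> Iv Ib body.
(* Induction on the number [d] of rounds still to run. *)
have loop d i M : i + d = m -> I i M -> nmem M v 0 = i ->
    exists n M', [/\ exec (While (NLe (NAdd (var v) (NConst 1)) b)
         (Seq p (NSet v (NConst 0) (NAdd (var v) (NConst 1))))) M n M',
       n <= d * (T + 2) + 1 & I m M'].
  elim: d i M => [|d IH] i M dm IM vi.
    exists 1, M; split=> //; last by rewrite -dm addn0.
    by apply: ExecWhileFalse; rewrite /= (Ib _ _ IM) vi; lia.
  have [|n [M1 [ex1 le_n [IM1 vi1]]]] := body i _ M (conj IM vi); first by lia.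
  have [|||n' [M2 [ex2 le_n' IM2]]] := IH i.+1 (nset M1 v 0 (nmem M1 v 0 + 1)).
  - by lia.
  - exact: Iv.
  - by rewrite /= /update !eqxx /= vi1 addn1.
  exists (n + 1 + n').+1, M2; split=> //; last by lia.
  apply: ExecWhileTrue ex2; first by rewrite /= (Ib _ _ IM) vi; lia.
  by apply: ExecSeq ex1 _; have := ExecNSet v (NConst 0) (NAdd (var v) (NConst 1)) M1.
move=> M I0.
have [|||n [M' [ex le_n IM]]] := loop m 0 (nset M v 0 0); rewrite ?add0n //.
- exact: Iv.
- by rewrite /= /update !eqxx.
exists (1 + n), M'; split=> //; last by lia.
by apply: ExecSeq ex; have := ExecNSet v (NConst 0) (NConst 0) M.
Qed.

End Triples.

(** * The search *)

(* Memory layout of the search. Nat arrays 0 and 2-5 and real array 0 hold the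
   graph as in both encodings. Further nat cells: 10 the duration bound, 11 the
   start edge, 12 the round, 13 and 14 the tail and head of the arc being
   relaxed, 15 (an array) the labelled edges, 16 the result; real array 2 holds
   the cost bound, 3 the labels. *)

Definition eq_test x y := TAnd (NLe x y) (NLe y x).

Definition candidate_cost := RAdd (RCell 3 (var 13)) (RCell 0 (var 14)).

(** An unset flag in array 15 stands for an infinite label, so the last conjunct reads: the head is
    unlabelled or the candidate is strictly cheaper. *)
Definition relax_test :=
  TAnd (NLe (NConst 1) (NCell 15 (var 13)))
  (TAnd (eq_test (NCell 3 (var 13)) (NCell 2 (var 14)))
  (TAnd (NLe (NAdd (NCell 4 (var 13)) (NCell 5 (var 13))) (NCell 4 (var 14)))
  (TNot (TAnd (NLe (NConst 1) (NCell 15 (var 14)))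
              (RLe (RCell 3 (var 14)) candidate_cost))))).

Definition relax :=
  If relax_test
    (Seq (NSet 15 (var 14) (NConst 1)) (RSet 3 (var 14) candidate_cost)) Skip.

Definition edge_count := NCell 0 (NConst 1).

Definition relax_all := for_loop 13 edge_count (for_loop 14 edge_count relax).

(** Clearing the flags suffices to discard the labels of the previous start edge, as stale costs are
    masked by unset flags. *)
Definition init_labels :=
  Seq (for_loop 14 edge_count (NSet 15 (var 14) (NConst 0)))
  (Seq (NSet 15 (var 11) (NConst 1)) (RSet 3 (var 11) (RCell 0 (var 11)))).

Definition found_duration :=
  NSub (NAdd (NCell 4 (var 14)) (NCell 5 (var 14))) (NCell 4 (var 11)).

Definition found_cost := RCell 3 (var 14).

(* The test that the terminals differ is needed because closed walks exist,
   whereas a path from a vertex to itself does not. *)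
Definition collect b :=
  for_loop 14 edge_count
    (If (TAnd (NLe (NConst 1) (NCell 15 (var 14)))
        (TAnd (eq_test (NCell 3 (var 14)) (NCell 0 (NConst 3)))
        (TAnd (TNot (eq_test (NCell 0 (NConst 2)) (NCell 0 (NConst 3)))) b)))
      (NSet 16 (NConst 0) (NConst 1)) Skip).

Definition search b :=
  Seq (NSet 16 (NConst 0) (NConst 0))
    (for_loop 11 edge_count
      (If (eq_test (NCell 2 (var 11)) (NCell 0 (NConst 2)))
        (Seq init_labels
        (Seq (for_loop 12 edge_count relax_all) (collect b))) Skip)).

Section Search.
Variables (R : realType) (G : wtgraph R) (s z : vertex G) (D : nat) (C : R).
Implicit Types (M : memory R) (e f : tedge R (vertex G)).

Let m := size (edges G).
Let edge i := nth (TEdge s s 0 0 0%R) (edges G) i.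

Definition represents M : Prop :=
  [/\ nmem M 0 1 = m, nmem M 0 2 = vertex_code s, nmem M 0 3 = vertex_code z,
      nmem M 10 0 = D & rmem M 2 0 = C] /\
  forall i, i < m ->
    [/\ nmem M 2 i = vertex_code (src (edge i)),
        nmem M 3 i = vertex_code (dst (edge i)),
        nmem M 4 i = time (edge i), nmem M 5 i = trav (edge i)
      & rmem M 0 i = cost (edge i)].

(** Both problems ask for a path whose duration and cost satisfy a condition preserved when either
    decreases. Abstracting it as [ok], tested by [b], lets one search serve both. *)
Variables (b : test) (ok : nat -> R -> bool).
Hypothesis b_ok : forall M, represents M ->
  teval M b = ok (neval M found_duration) (reval M found_cost).
Hypothesis ok_le : forall d d' c c', d' <= d -> (c' <= c)%R -> ok d c -> ok d' c'.

(** * Paths against walks between listed edges *)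

Definition solvable : Prop :=
  exists P, is_tpath s z P /\ ok (duration P) (path_cost P).

Definition solved_by i l j c : Prop :=
  [/\ src (edge i) = s, dst (edge j) = z, s != z, walk (edge i) l (edge j) c
    & ok (time (edge j) + trav (edge j) - time (edge i)) c].

Lemma edge_in i : i < m -> edge i \in edges G.
Proof. exact: mem_nth. Qed.

Lemma edge_index e : e \in edges G -> exists2 i, i < m & e = edge i.
Proof.
by move=> eG; exists (index e (edges G)); rewrite ?index_mem // /edge nth_index.
Qed.

Lemma solved_solvable i l j c : i < m -> solved_by i l j c -> solvable.
Proof.
move=> im [si zj sNz w okc].
have [P [PG eP lastP costP]] := walk_path w.
have [||Q [Qp dQ cQ]] := @walk_tpath _ _ (edge i) z P (edge_in im) PG eP.
- by rewrite lastP.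
- by rewrite si.
exists Q; split; first by rewrite -{1}si.
by apply: ok_le dQ cQ _; rewrite costP /duration /= lastP.
Qed.

Lemma solvable_solved : solvable ->
  exists i l j c, [/\ i < m, l <= m, j < m & solved_by i l j c].
Proof.
move=> [[|e P] [// Pp okP]].
have /= szP := size_tpath Pp.
case/and5P: Pp => /= /andP[eG PG] /eqP se eP /eqP zP uP.
have [i im def_e] := edge_index eG.
have [j jm def_l] : exists2 j, j < m & last e P = edge j.
  apply: edge_index; have := mem_last e P.
  by rewrite inE => /predU1P[-> //|]; apply: (allP PG).
exists i, (size P), j, (path_cost (e :: P)); split=> //; first exact: ltnW.
split; rewrite -?def_e -?def_l //; last exact: path_walk.
(* Equal terminals would make the first vertex reappear as the head of the last edge. *)
rewrite -zP -se; apply: contraTneq uP => ->.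
by rewrite -[dst _]last_map mem_last.
Qed.

(** * Labels and loop invariants *)

Definition result_upto i0 M : Prop :=
  (nmem M 16 0 <> 0 -> solvable) /\
  forall i l j c, i < i0 -> l <= m -> j < m -> solved_by i l j c -> nmem M 16 0 <> 0.

Definition labelled M j c := 0 < nmem M 15 j /\ (rmem M 3 j <= c)%R.

Definition sound i0 M := forall j, j < m -> 0 < nmem M 15 j ->
  exists l, walk (edge i0) l (edge j) (rmem M 3 j).

Definition complete i0 k M := forall l j c, l <= k -> j < m ->
  walk (edge i0) l (edge j) c -> labelled M j c.

Definition context i0 M :=
  [/\ represents M, result_upto i0 M & nmem M 11 0 = i0].

Definition relaxed i0 k i M j := forall l c, l <= k ->
  walk (edge i0) l (edge i) c -> follows (edge i) (edge j) ->
  labelled M j (c + cost (edge j))%R.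

Lemma vertex_code_inj (V : finType) : injective (@vertex_code V).
Proof. by move=> u v eq_uv; apply/enum_rank_inj/ord_inj. Qed.

Lemma vertex_code_eq (V : finType) (u v : V) :
  (vertex_code u <= vertex_code v) && (vertex_code v <= vertex_code u) = (u == v).
Proof. by rewrite -eqn_leq (inj_eq (@vertex_code_inj V)). Qed.

(* Labels are updated in place, so rounds after the k-th may be anticipated; the
   invariant only survives because labels never increase. *)
Definition arcs_relaxed i0 k i j M : Prop :=
  [/\ context i0 M, sound i0 M, complete i0 k M,
      forall i' j', i' < i -> j' < m -> relaxed i0 k i' M j'
    & forall j', j' < j -> relaxed i0 k i M j'].

(** A failed test on an arc means that the head is already labelled cheaply enough; a successful one
    records a walk one arc longer. Labels only improve, so everything established before
    persists. *)
Lemma relax_correct i0 k i j : i < m -> j < m ->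
  triple (fun M => (arcs_relaxed i0 k i j M /\ nmem M 12 0 = k /\ nmem M 13 0 = i)
                   /\ nmem M 14 0 = j)
         relax 3
         (fun M => (arcs_relaxed i0 k i j.+1 M /\ nmem M 12 0 = k /\ nmem M 13 0 = i)
                   /\ nmem M 14 0 = j).
Proof.
move=> im jm M [[[ctxM snd cmp rel1 rel2] [Mk Mi]] Mj].
have [rep resM Mi0] := ctxM.
have [_ /(_ i im) [src_i dst_i time_i trav_i cost_i]] := rep.
have [_ /(_ j jm) [src_j dst_j time_j trav_j cost_j]] := rep.
have tE : teval M relax_test = [&& 0 < nmem M 15 i, follows (edge i) (edge j) &
    ~~ ((0 < nmem M 15 j) && (rmem M 3 j <= rmem M 3 i + cost (edge j))%R)].
  rewrite /= Mi Mj dst_i src_j vertex_code_eq time_i trav_i time_j cost_j.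
  by rewrite /follows !andbA.
case: (boolP (teval M relax_test)) => tM; last first.
  exists 2, M; split=> //; first exact: ExecIfFalse tM (ExecSkip _).
  split=> //; split=> //; split=> // j'.
  rewrite ltnS leq_eqVlt => /predU1P[->|]; last exact: rel2.
  (* By completeness [i] is labelled with cost at most [c], so the test can only have failed because
     of the label of [j]. *)
  move=> l c le_l w ij; move: tM; rewrite tE ij.
  have [lab_i le_c] := cmp _ _ _ le_l im w.
  rewrite lab_i negbK => /andP[lab_j le_j]; split=> //.
  by apply: le_trans le_j _; rewrite lerD2r.
have costE : (rmem M 3 i + cost (edge j) =
            reval (nset M 15 j 1) candidate_cost)%R.
  by rewrite /= /update /= Mi Mj cost_j.
pose M' := rset (nset M 15 j 1) 3 j (rmem M 3 i + cost (edge j))%R.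
have exM : exec relax M 3 M'.
  apply: ExecIfTrue tM _; apply: (@ExecSeq _ _ _ _ 1 (nset M 15 j 1) 1).
    by have := ExecNSet 15 (var 14) (NConst 1) M; rewrite /= Mj.
  have := ExecRSet 3 (var 14) candidate_cost (nset M 15 j 1).
  by rewrite -costE /= /update /= Mj.
move: tM; rewrite tE => /and3P[lab_i ij improves].
have M'lab j' : nmem M' 15 j' = if j' == j then 1 else nmem M 15 j' by [].
have M'cost j' : rmem M' 3 j' =
    if j' == j then (rmem M 3 i + cost (edge j))%R else rmem M 3 j' by [].
have mono j' c : labelled M j' c -> labelled M' j' c.
  rewrite /labelled M'lab M'cost; case: eqP => // -> [lab_j le_c]; split=> //.
  move: improves; rewrite lab_j -ltNge => /ltW lt_j; exact: le_trans lt_j le_c.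
exists 3, M'; split=> //; split=> //; split=> //; split=> //.
- move=> j' j'm; rewrite M'lab M'cost; case: eqP => [-> _|_]; last exact: snd.
  have [l w] := snd i im lab_i; exists l.+1.
  exact: WalkS w (edge_in jm) ij.
- by move=> l j' c le_l j'm /(cmp _ _ _ le_l j'm)/mono.
- by move=> i' j' i'i j'm l c le_l w f; apply: mono; apply: (rel1 i') w f.
move=> j'; rewrite ltnS leq_eqVlt => /predU1P[->|lt_j] l c le_l w f; last first.
  by apply: mono; apply: (rel2 j') w f.
rewrite /labelled M'lab M'cost eqxx; split=> //.
by rewrite lerD2r; case: (cmp _ _ _ le_l im w).
Qed.

Lemma edge_countE i0 M : context i0 M -> neval M edge_count = m.
Proof. by case=> -[[]]. Qed.

(** A walk with at most [k.+1] arcs is a single edge or extends one with at most [k] arcs by an arc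
    that this sweep has relaxed. *)
Lemma relax_all_correct i0 k : i0 < m ->
  triple (fun M => [/\ context i0 M, sound i0 M & complete i0 k M] /\ nmem M 12 0 = k)
    relax_all ((7 * m.+1 + 4) * m.+1)
    (fun M => [/\ context i0 M, sound i0 M & complete i0 k.+1 M] /\ nmem M 12 0 = k).
Proof.
move=> i0m; pose I i M := arcs_relaxed i0 k i 0 M /\ nmem M 12 0 = k.
have loop : triple (I 0) relax_all ((7 * m.+1 + 4) * m.+1) (I m).
  apply: triple_for => [i M x|i M [[/edge_countE]]|i im] //.
  pose J j M := arcs_relaxed i0 k i j M /\ nmem M 12 0 = k /\ nmem M 13 0 = i.
  have loopJ : triple (J 0) (for_loop 14 edge_count relax) (7 * m.+1) (J m).
    apply: (@triple_for _ _ _ _ _ _ 3) => [j M x|j M [[/edge_countE]]|j jm] //.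
    exact: relax_correct.
  apply: triple_weaken loopJ _ _ _ => // M; first by case=> -[].
  case=> -[ctxM snd cmp rel1 rel2] [Mk Mi]; split=> //; split=> //; split=> //.
  by move=> i' j'; rewrite ltnS leq_eqVlt => /predU1P[->|]; [apply: rel2|apply: rel1].
apply: triple_weaken loop _ _ _ => // M.
  by case=> -[ctxM snd cmp] Mk; split=> //; split.
case=> -[ctxM snd cmp rel _] Mk; split=> //; split=> // l j c le_l jm w.
move def_e: (edge j) w => e w.
case: w def_e le_l => [|{}l {}e f {}c w fG ef] def_f le_l.
  by apply: cmp (leq0n k) jm _; rewrite def_f; apply: Walk1.
have eG := walk_in (edge_in i0m) w.
have [i im def_e] := edge_index eG.
by rewrite -def_f; apply: (rel i j im jm l); rewrite -?def_e ?def_f.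
Qed.

Lemma init_labels_correct i0 : i0 < m ->
  triple (context i0) init_labels (5 * m.+1 + 2)
    (fun M => [/\ context i0 M, sound i0 M & complete i0 0 M]).
Proof.
move=> i0m.
pose I j M := context i0 M /\ forall j', j' < j -> nmem M 15 j' = 0.
have loop : triple (I 0) (for_loop 14 edge_count (NSet 15 (var 14) (NConst 0)))
    (5 * m.+1) (I m).
  apply: (@triple_for _ _ _ _ _ _ 1) => [j M x|j M [/edge_countE]|j jm] //.
  apply: triple_nset => M [[ctxM lab] Mj]; split=> //; split=> // j'.
  rewrite /= Mj /update /= ltnS leq_eqVlt => /predU1P[->|lt_j]; first by rewrite eqxx.
  by case: eqP => // _; apply: lab.
apply: triple_seq (triple_weaken loop _ (leqnn _) (fun _ => id)) _.
  by move=> M ctxM; split.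
move=> M [ctxM lab]; have [rep _ Mi0] := ctxM.
have [_ /(_ i0 i0m) [_ _ _ _ cost_i0]] := rep.
pose M' := rset (nset M 15 i0 1) 3 i0 (cost (edge i0)).
have M'lab j' : nmem M' 15 j' = if j' == i0 then 1 else nmem M 15 j' by [].
have M'cost : rmem M' 3 i0 = cost (edge i0) by rewrite /= /update !eqxx.
exists 2, M'; split=> //.
  apply: (@ExecSeq _ _ _ _ 1 (nset M 15 i0 1) 1).
    by have := ExecNSet 15 (var 11) (NConst 1) M; rewrite /= Mi0.
  have := ExecRSet 3 (var 11) (RCell 0 (var 11)) (nset M 15 i0 1).
  by rewrite /= /update /= Mi0 cost_i0.
split=> //.
  move=> j jm; rewrite M'lab; case: eqP => [->|_]; last by rewrite lab.
  by rewrite M'cost => _; exists 0; apply: Walk1.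
move=> l j c; rewrite leqn0 => /eqP-> jm w.
(* A walk without arcs is the start edge, and a duplicate-free listing gives it only one index. *)
have [-> -> ] : j = i0 /\ c = cost (edge i0).
  move def_e: (edge j) w => e w; move def_l: 0 w => l' w.
  case: w def_l def_e => // _ /eqP.
  by rewrite nth_uniq ?edges_uniq // => /eqP.
by rewrite /labelled M'lab M'cost eqxx.
Qed.

(** A positive test is justified by [sound], as the label is the cost of a real walk. Conversely,
    [complete] bounds the label by the cost of any solving walk, and [ok_le] transfers acceptance to
    the label. *)
Lemma collect_correct i0 : i0 < m -> src (edge i0) = s ->
  triple (fun M => [/\ context i0 M, sound i0 M & complete i0 m M])
    (collect b) (6 * m.+1)
    (fun M => [/\ represents M, result_upto i0.+1 M & nmem M 11 0 = i0]).
Proof.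
move=> i0m src_i0.
pose I j M := [/\ context i0 M, sound i0 M, complete i0 m M &
  forall l j' c, l <= m -> j' < j -> solved_by i0 l j' c -> nmem M 16 0 <> 0].
have loop : triple (I 0) (collect b) (6 * m.+1) (I m).
  apply: (@triple_for _ _ _ _ _ _ 2) => [j M x|j M [/edge_countE]|j jm] //.
  move=> M [[ctxM snd cmp res] Mj]; have [rep [res1 res2] Mi0] := ctxM.
  have [[_ Ms Mz _ _]] := rep => /[dup]
    /(_ i0 i0m) [_ _ time_i0 _ _] /(_ j jm) [_ dst_j time_j trav_j _].
  set t := TAnd _ _.
  have tE : teval M t = [&& 0 < nmem M 15 j, dst (edge j) == z, s != z &
      ok (time (edge j) + trav (edge j) - time (edge i0)) (rmem M 3 j)].
    rewrite /= b_ok // /found_duration /found_cost /= Mj Mi0 dst_j Ms Mz.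
    by rewrite !vertex_code_eq time_j trav_j time_i0.
  case: (boolP (teval M t)) => tM.
    exists 2, (nset M 16 0 1); split=> //.
      by apply: ExecIfTrue tM _; have := ExecNSet 16 (NConst 0) (NConst 1) M.
    split=> //; split=> //; split=> //; split=> // _.
    move: tM; rewrite tE => /and4P[lab_j /eqP zj sNz okj].
    have [l w] := snd j jm lab_j.
    by apply: (@solved_solvable i0 l j (rmem M 3 j)).
  exists 2, M; split=> //; first exact: ExecIfFalse tM (ExecSkip _).
  split=> //; split=> // l j' c le_l; rewrite ltnS leq_eqVlt.
  case/predU1P=> [->|]; last exact: res.
  case=> _ zj sNz w okc; have [lab_j le_c] := cmp l j c le_l jm w.
  by move: tM; rewrite tE lab_j zj eqxx sNz (ok_le _ le_c okc).
apply: triple_weaken loop _ _ _ => // M; first by case.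
case=> -[rep [res1 res2] Mi0] _ _ res; split=> //; split=> // i l j c.
rewrite ltnS leq_eqVlt => /predU1P[->|]; last exact: res2.
by move=> le_l jm; apply: res.
Qed.

(** The fourth power comes from the nested loops over start edge, round, tail and head of an arc. *)
Lemma search_correct :
  triple represents (search b) (100 * m.+1 ^ 4)
    (fun M => nmem M 16 0 <> 0 <-> solvable).
Proof.
pose I i M := represents M /\ result_upto i M.
pose T_rounds := ((7 * m.+1 + 4) * m.+1 + 4) * m.+1.
(* As a polynomial in [m.+1] this has degree 4 and coefficients summing to 34, well below the
   claimed 100. *)
pose T := 1 + ((5 * m.+1 + 2 + (T_rounds + 6 * m.+1)).+1 + 4) * m.+1.
apply: (@triple_weaken _ represents _ _ T _ (I m)) => //; last first.
- move=> M [_ [res1 res2]]; split=> // /solvable_solved.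
  by case=> i [l [j [c [im le_l jm sol]]]]; apply: res2 sol.
- by rewrite /T /T_rounds; have: 0 < m.+1 by []; move: m.+1 => n; nia.
apply: triple_seq (_ : triple _ _ _ (I 0)) _.
  by apply: triple_nset => M rep; split.
apply: triple_for => [i M x|i M [[[]]]|i im] //.
have tE M : represents M -> nmem M 11 0 = i ->
    teval M (eq_test (NCell 2 (var 11)) (NCell 0 (NConst 2)))
    = (src (edge i) == s).
  move=> [[_ Ms _ _ _] /(_ i im) [src_i _ _ _ _]] Mi.
  by rewrite /= Mi Ms src_i vertex_code_eq.
apply: triple_if; last first.
  apply: triple_weaken (triple_skip (fun _ => id)) (fun _ => id) _ _ => //.
  move=> M [[[rep [res1 res2]] Mi]]; rewrite tE // => /eqP srcNs.
  split=> //; split=> //; split=> // i' l j c.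
  by rewrite ltnS leq_eqVlt => /predU1P[-> _ _ []|]; last exact: res2.
have [src_i|srcNs] := eqVneq (src (edge i)) s; last first.
  by move=> M [[[rep _] Mi]]; rewrite tE // (negPf srcNs).
have rounds : triple (fun M => [/\ context i M, sound i M & complete i 0 M])
    (for_loop 12 edge_count relax_all) T_rounds
    (fun M => [/\ context i M, sound i M & complete i m M]).
  pose J k M := [/\ context i M, sound i M & complete i k M].
  apply: (@triple_for _ J) => [k M x|k M [/edge_countE]|k km] //.
  exact: relax_all_correct.
apply: triple_seq (triple_seq rounds _).
  apply: triple_weaken (init_labels_correct im) _ _ (fun _ => id) => // M.
  by case=> -[[rep res] Mi].
apply: triple_weaken (collect_correct im src_i) (fun _ => id) _ _ => // M.
by case.
Qed.

Lemma represents_arrays M :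
  [/\ nmem M 0 1 = m, nmem M 0 2 = vertex_code s, nmem M 0 3 = vertex_code z,
      nmem M 10 0 = D & rmem M 2 0 = C] ->
  (forall a i, 2 <= a < 6 ->
    nmem M a i = nth 0 (nth [::] (tedges_nats (edges G)) (a - 2)) i) ->
  (forall i, rmem M 0 i = nth 0%R (tedges_costs (edges G)) i) ->
  represents M.
Proof.
move=> cells nats costs; split=> // i im.
by rewrite costs !nats //= !(nth_map (TEdge s s 0 0 0%R)).
Qed.

End Search.

(** * The two programs *)

Definition existence_test :=
  TAnd (NLe found_duration (var 10)) (RLe found_cost (RCell 2 (NConst 0))).

Definition existence_program :=
  Seq (NSet 10 (NConst 0) (NCell 0 (NConst 4)))
  (Seq (RSet 2 (NConst 0) (RCell 1 (NConst 0)))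
  (Seq (search existence_test) (NSet 0 (NConst 0) (var 16)))).

(** A disjunction written with De Morgan, strict comparisons being negated reversed ones. *)
Definition domination_test :=
  TNot (TAnd
    (TNot (TAnd (TNot (RLe (RCell 2 (NConst 0)) found_cost))
                (NLe found_duration (var 10))))
    (TNot (TAnd (RLe found_cost (RCell 2 (NConst 0)))
                (TNot (NLe (var 10) found_duration))))).

(** In the encoding, nat arrays 6 to 9 describe the given path; its number of edges is in cell 4 of
    array 0, hence the last index is one less. *)
Definition path_duration :=
  let last_edge := NSub (NCell 0 (NConst 4)) (NConst 1) in
  NSub (NAdd (NCell 8 last_edge) (NCell 9 last_edge)) (NCell 8 (NConst 0)).

Definition sum_costs :=
  for_loop 14 (NCell 0 (NConst 4))
    (RSet 2 (NConst 0) (RAdd (RCell 2 (NConst 0)) (RCell 1 (var 14)))).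

Definition efficiency_program :=
  Seq (NSet 10 (NConst 0) path_duration)
  (Seq sum_costs
  (Seq (search domination_test)
       (NSet 0 (NConst 0) (NSub (NConst 1) (var 16))))).

Section Decide.
Variable R : realType.

Lemma existence_poly_time :
  poly_time_decidable (@encode_existence R) (@existence_yes R).
Proof.
(* 100 for the search and 3 for the assignments around it. *)
exists existence_program, 103, 4 => -[G s z C D C_ge0].
set x := encode_existence _; set N := (input_size x).+1.
have leN : (size (edges G)).+1 <= N.
  (* Each edge contributes its cost, a real of size 1, to the input size. *)
  by rewrite /N /input_size /x /= !big_cons /tedges_costs size_map; lia.
pose ok d c := (d <= D) && (c <= C)%R.
pose M0 := rset (nset (load x) 10 0 D) 2 0 C.
have rep0 : represents s z D C M0.
  by apply: represents_arrays => // -[|[|[|[|[|[|a]]]]]].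
have b_ok M : represents s z D C M -> teval M existence_test =
    ok (neval M found_duration) (reval M found_cost).
  by case=> -[_ _ _ MD MC] _; rewrite /ok -MD -MC.
have ok_le d d' c c' : d' <= d -> (c' <= c)%R -> ok d c -> ok d' c'.
  by move=> le_d le_c /andP[le_D le_C]; rewrite /ok (leq_trans le_d) // (le_trans le_c).
have [n [M [ex le_n resM]]] := search_correct b_ok ok_le rep0.
exists (1 + (1 + (n + 1))), (nset M 0 0 (nmem M 16 0)); split.
- apply: ExecSeq (_ : exec _ _ _ (nset (load x) 10 0 D)) _.
    exact: ExecNSet 10 (NConst 0) (NCell 0 (NConst 4)) (load x).
  apply: ExecSeq (_ : exec _ _ _ M0) _.
    exact: ExecRSet 2 (NConst 0) (RCell 1 (NConst 0)) (nset (load x) 10 0 D).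
  apply: ExecSeq ex _; exact: ExecNSet 0 (NConst 0) (var 16) M.
- have N4_gt0 : 0 < N ^ 4 by rewrite expn_gt0.
  have : (size (edges G)).+1 ^ 4 <= N ^ 4 by rewrite leq_exp2r.
  lia.
apply: (iff_trans resM); split.
  by case=> P [Pp /andP[leD leC]]; exists P.
by case=> P [Pp leD leC]; exists P; split; last exact/andP.
Qed.

(** The search looks for a dominating path, with the duration and cost of the given path as bounds,
    and the answer is complemented. *)
Lemma efficiency_poly_time :
  poly_time_decidable (@encode_efficiency R) (@efficiency_yes R).
Proof.
(* 100 for the search, 5 for the loop summing the path costs and 2 for the outer assignments. *)
exists efficiency_program, 107, 4 => -[G s z P Pp].
set x := encode_efficiency _; set N := (input_size x).+1.
have leN : (size (edges G)).+1 <= N.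
  by rewrite /N /input_size /x /= !big_cons /tedges_costs !size_map; lia.
have lePN : (size P).+1 <= N.
  by rewrite /N /input_size /x /= !big_cons /tedges_costs !size_map; lia.
pose D := duration P; pose C := path_cost P.
pose ok d c := ((c < C)%R && (d <= D)) || ((c <= C)%R && (d < D)).
have b_ok M : represents s z D C M -> teval M domination_test =
    ok (neval M found_duration) (reval M found_cost).
  case=> -[_ _ _ MD MC] _; rewrite /ok -MD -MC ltNge ltnNge.
  by rewrite [LHS]/= negb_and !negbK.
have ok_le d d' c c' : d' <= d -> (c' <= c)%R -> ok d c -> ok d' c'.
  rewrite /ok => le_d le_c /orP[/andP[lt_C le_D]|/andP[le_C lt_D]].
    by rewrite (le_lt_trans le_c) // (leq_trans le_d).
  by rewrite (le_trans le_c) //= (leq_ltn_trans le_d) // orbT.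
pose M0 := nset (load x) 10 0 D.
(* Summation touches only the counter array 14 and real array 2. The accumulator starts at 0 because
   cells outside the input do. *)
pose I j (M : memory R) := [/\ forall a i, a != 14 -> nmem M a i = nmem M0 a i,
  forall a i, a != 2 -> rmem M a i = rmem M0 a i &
  rmem M 2 0 = (\sum_(0 <= k < j) nth 0 (tedges_costs P) k)%R].
have sum : triple (I 0) sum_costs (5 * (size P).+1) (I (size P)).
  apply: (@triple_for _ I _ _ _ _ 1) => [j M c [MN MR MC]|j M [MN _ _]|j jP].
  - by split=> // a i aN14; rewrite -MN //= /update (negPf aN14).
  - by rewrite /= MN.
  apply: triple_rset => M [[MN MR MC] Mj]; split=> //; split=> // [a i aN2|].
    by rewrite -MR //= /update (negPf aN2).
  by rewrite /= /update /= MC Mj MR // big_nat_recr.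
have [|n1 [M1 [ex1 le_n1 [MN MR MC]]]] := sum M0.
  by split=> //; rewrite big_geq.
have rep1 : represents s z D C M1.
  apply: represents_arrays => [|a i a26|i]; last by rewrite MR.
    by split; rewrite ?MN // MC /C path_cost_nth.
  rewrite MN; last by apply: contraTneq a26 => ->.
  by case: a a26 => [|[|[|[|[|[|a]]]]]].
have [n2 [M2 [ex2 le_n2 res]]] := search_correct b_ok ok_le rep1.
exists (1 + (n1 + (n2 + 1))), (nset M2 0 0 (1 - nmem M2 16 0)); split.
- apply: ExecSeq (_ : exec _ _ _ M0) _.
    have := ExecNSet 10 (NConst 0) path_duration (load x).
    rewrite (_ : neval _ path_duration = D) //.
    by rewrite /D duration_nth.
  apply: ExecSeq ex1 _; apply: ExecSeq ex2 _.
  exact: ExecNSet 0 (NConst 0) (NSub (NConst 1) (var 16)) M2.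
- have N4_gt0 : 0 < N ^ 4 by rewrite expn_gt0.
  have leNN4 : N <= N ^ 4 by rewrite -{1}(expn1 N) leq_pexp2l.
  have : (size (edges G)).+1 ^ 4 <= N ^ 4 by rewrite leq_exp2r.
  lia.
have yes : solvable s z ok <-> exists Q, is_tpath s z Q /\ dominates Q P.
  split=> -[Q [Qp dom]]; exists Q; split=> //.
    by case/orP: dom => /andP[]; [left|right].
  by apply/orP; case: dom => -[lc ld]; [left|right]; apply/andP.
rewrite /efficiency_yes /efficient /accepting /= /update /=.
split=> [acc /yes/res|eff]; first by move: acc; case: (nmem M2 16 0).
(* The answer is 1 minus the search flag, and a nonzero flag would yield a dominating path. *)
have -> // : nmem M2 16 0 = 0.
by apply/eqP; apply: contra_notT eff => /eqP/res/yes.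
Qed.
End Decide.

Theorem theorem3 (R : realType) :
  poly_time_decidable (@encode_efficiency R) (@efficiency_yes R) /\
  poly_time_decidable (@encode_existence R) (@existence_yes R).
Proof. by split; [apply: efficiency_poly_time|apply: existence_poly_time]. Qed.
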